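(* Let $\phi:R\to S$ be a homomorphism of commutative rings (unital). Let $A,B$ be diagrams of $\mathrm{RING}_R$ with the same numbers of inputs and outputs. If $\llbracket A\rrbracket=\llbracket B\rrbracket$, then $\llbracket\hat\phi A\rrbracket=\llbracket\hat\phi B\rrbracket$ in $\mathrm{RING}_S$. The same is true with $\mathrm{RING}$ replaced by $\mathrm{ZW}$, and (when $R$ contains an element $\tfrac12$ inverse to $2$) with $\mathrm{RING}$ replaced by $\mathrm{ZH}$.
   Context: For a commutative ring $R$, each of the calculi below is a compact closed PROP of diagrams with a strict symmetric monoidal interpretation functor $\llbracket\cdot\rrbracket$ sending a diagram $n\to m$ to a matrix over $R$ with $2^n$ columns and $2^m$ rows (composition is matrix product, tensor is Kronecker product). In all of them the identity wire is $I_2$, the swap is $|xy\rangle\mapsto|yx\rangle$, the cap $2\to 0$ is $(1\ 0\ 0\ 1)$, the cup $0\to 2$ is $(1\ 0\ 0\ 1)^T$. The further generators are: - $\mathrm{RING}_R$: states $0\to1$ labelled by $a\in R$, interpreted as $(1,a)^T$; multiplication $2\to1$, $\begin{pmatrix}1&0&0&0\\0&0&0&1\end{pmatrix}$; addition $2\to1$, $\begin{pmatrix}1&0&0&0\\0&1&1&0\end{pmatrix}$. - $\mathrm{ZW}_R$: white spiders $m\to n$ labelled by $r\in R$, interpreted as $|0\cdots0\rangle\langle0\cdots0|+r|1\cdots1\rangle\langle1\cdots1|$; unlabelled black spiders $0\to n$, interpreted as $\sum_{k=1}^n|0^{k-1}1\,0^{n-k}\rangle$; and the unlabelled crossing $2\to2$,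 $\begin{pmatrix}1&0&0&0\\0&0&1&0\\0&1&0&0\\0&0&0&-1\end{pmatrix}$. - $\mathrm{ZH}_R$ (for $R$ with $\tfrac12$): unlabelled white spiders $m\to n$, interpreted as $|0\cdots0\rangle\langle0\cdots0|+|1\cdots1\rangle\langle1\cdots1|$; H-boxes $m\to n$ labelled by $r\in R$, interpreted as $\sum r^{i_1\cdots i_mj_1\cdots j_n}|j_1\cdots j_n\rangle\langle i_1\cdots i_m|$, the sum over all bits $i_k,j_l\in\{0,1\}$. Given $\phi:R\to S$, $\hat\phi$ is the strict symmetric monoidal functor from diagrams over $R$ to diagrams over $S$ that replaces each label $a\in R$ on a labelled generator by $\phi(a)\in S$ and leaves everything else (unlabelled generators, wires, swaps, cups, caps) unchanged. *)

(* Defs.v *)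
From mathcomp Require Import all_boot all_algebra.
From mathcomp.real_closed Require Import mxtens.

Set Implicit Arguments.
Unset Strict Implicit.
Unset Printing Implicit Defensive.

Import GRing.Theory.
Local Open Scope ring_scope.

(* Diagrams n -> m over a family G of generators.  A term represents a         *)
(* morphism of the compact closed PROP; the PROP and compact closure equations *)
(* hold between interpretations and are preserved by relabelling, so a         *)
(* statement about the interpretations of all terms is the same as one about   *)
(* all classes of terms.                                                       *)
(* Since closed arities compute, composites are typed strictly: no             *)
(* associators or unitors are needed.                                          *)
Inductive diagram (G : nat -> nat -> Type) : nat -> nat -> Type :=
| DGen n m of G n m : diagram G n m
| DEmpty : diagram G 0 0
| DWire : diagram G 1 1
| DSwap : diagram G 2 2
| DCap : diagram G 2 0
| DCup : diagram G 0 2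
| DComp n k m of diagram G n k & diagram G k m : diagram G n m
| DTens n1 m1 n2 m2 of diagram G n1 m1 & diagram G n2 m2 :
    diagram G (n1 + n2) (m1 + m2).

Arguments DEmpty {G}.
Arguments DWire {G}.
Arguments DSwap {G}.
Arguments DCap {G}.
Arguments DCup {G}.

Fixpoint dmap (G H : nat -> nat -> Type) (f : forall n m, G n m -> H n m)
    n m (D : diagram G n m) : diagram H n m :=
  match D in diagram _ n m return diagram H n m with
  | DGen _ _ g => DGen (f _ _ g)
  | DEmpty => DEmpty
  | DWire => DWire
  | DSwap => DSwap
  | DCap => DCap
  | DCup => DCup
  | DComp _ _ _ A B => DComp (dmap f A) (dmap f B)
  | DTens _ _ _ _ A B => DTens (dmap f A) (dmap f B)
  end.

Section Interpretation.

Variable R : comPzRingType.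

Definition mx_of_rows p q (rows : seq (seq R)) : 'M[R]_(p, q) :=
  \matrix_(i, j) (nth [::] rows i)`_j.

(* Kronecker product; the first factor is the most significant one. *)
Definition kron m1 n1 m2 n2
    (A : 'M[R]_(2 ^ m1, 2 ^ n1)) (B : 'M[R]_(2 ^ m2, 2 ^ n2)) :
    'M[R]_(2 ^ (m1 + m2), 2 ^ (n1 + n2)) :=
  castmx (esym (expnD 2 m1 m2), esym (expnD 2 n1 n2)) (A *t B).

(* Big-endian, in agreement with [kron]; see [ket_cat]. *)
Definition bits_val (b : seq bool) : nat := foldl (fun v (x : bool) => v.*2 + x)%N 0%N b.

Definition ket n (b : n.-tuple bool) : 'M[R]_(2 ^ n, 2 ^ 0) :=
  \matrix_(i, _) (i == bits_val b :> nat)%:R.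

Definition bra n (b : n.-tuple bool) : 'M[R]_(2 ^ 0, 2 ^ n) := (ket b)^T.

Definition ketbra m n (b : m.-tuple bool) (c : n.-tuple bool) :
  'M[R]_(2 ^ m, 2 ^ n) := ket b *m bra c.

Fixpoint interp (G : nat -> nat -> Type)
    (gi : forall n m, G n m -> 'M[R]_(2 ^ m, 2 ^ n))
    n m (D : diagram G n m) : 'M[R]_(2 ^ m, 2 ^ n) :=
  match D in diagram _ n m return 'M[R]_(2 ^ m, 2 ^ n) with
  | DGen _ _ g => gi _ _ g
  | DEmpty => 1%:M
  | DWire => 1%:M
  | DSwap => \sum_(x : bool) \sum_(y : bool) ketbra [tuple y; x] [tuple x; y]
  | DCap => mx_of_rows _ _ [:: [:: 1; 0; 0; 1]]
  | DCup => mx_of_rows _ _ [:: [:: 1]; [:: 0]; [:: 0]; [:: 1]]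
  | DComp _ _ _ A B => interp gi B *m interp gi A
  | DTens _ _ _ _ A B => kron (interp gi A) (interp gi B)
  end.

End Interpretation.

Inductive ring_gen (R : Type) : nat -> nat -> Type :=
| RingState of R : ring_gen R 0 1
| RingMul : ring_gen R 2 1
| RingAdd : ring_gen R 2 1.

Inductive zw_gen (R : Type) : nat -> nat -> Type :=
| ZWWhite m n of R : zw_gen R m n
| ZWBlack n : zw_gen R 0 n
| ZWCrossing : zw_gen R 2 2.

Inductive zh_gen (R : Type) : nat -> nat -> Type :=
| ZHWhite m n : zh_gen R m n
| ZHBox m n of R : zh_gen R m n.

Arguments RingMul {R}.
Arguments RingAdd {R}.
Arguments ZWBlack {R} n.
Arguments ZWCrossing {R}.
Arguments ZHWhite {R} m n.

Section Relabelling.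

Variables (R S : Type) (phi : R -> S).

Definition ring_gen_map n m (g : ring_gen R n m) : ring_gen S n m :=
  match g in ring_gen _ n m return ring_gen S n m with
  | RingState a => RingState (phi a)
  | RingMul => RingMul
  | RingAdd => RingAdd
  end.

Definition zw_gen_map n m (g : zw_gen R n m) : zw_gen S n m :=
  match g in zw_gen _ n m return zw_gen S n m with
  | ZWWhite m n r => ZWWhite m n (phi r)
  | ZWBlack n => ZWBlack n
  | ZWCrossing => ZWCrossing
  end.

Definition zh_gen_map n m (g : zh_gen R n m) : zh_gen S n m :=
  match g in zh_gen _ n m return zh_gen S n m with
  | ZHWhite m n => ZHWhite m n
  | ZHBox m n r => ZHBox m n (phi r)
  end.

End Relabelling.

Section GeneratorInterpretation.

Variable R : comPzRingType.

Definition ring_gen_interp n m (g : ring_gen R n m) : 'M[R]_(2 ^ m, 2 ^ n) :=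
  match g in ring_gen _ n m return 'M[R]_(2 ^ m, 2 ^ n) with
  | RingState a => mx_of_rows _ _ [:: [:: 1]; [:: a]]
  | RingMul => mx_of_rows _ _ [:: [:: 1; 0; 0; 0]; [:: 0; 0; 0; 1]]
  | RingAdd => mx_of_rows _ _ [:: [:: 1; 0; 0; 0]; [:: 0; 1; 1; 0]]
  end.

Definition spider m n (r : R) : 'M[R]_(2 ^ n, 2 ^ m) :=
  ketbra R (nseq_tuple n false) (nseq_tuple m false)
  + r *: ketbra R (nseq_tuple n true) (nseq_tuple m true).

Definition zw_gen_interp n m (g : zw_gen R n m) : 'M[R]_(2 ^ m, 2 ^ n) :=
  match g in zw_gen _ n m return 'M[R]_(2 ^ m, 2 ^ n) with
  | ZWWhite m n r => spider m n r
  | ZWBlack n => \sum_(k < n) ket R [tuple i == k | i < n]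
  | ZWCrossing => mx_of_rows _ _
      [:: [:: 1; 0; 0; 0]; [:: 0; 0; 1; 0]; [:: 0; 1; 0; 0]; [:: 0; 0; 0; -1]]
  end.

Definition zh_gen_interp n m (g : zh_gen R n m) : 'M[R]_(2 ^ m, 2 ^ n) :=
  match g in zh_gen _ n m return 'M[R]_(2 ^ m, 2 ^ n) with
  | ZHWhite m n => spider m n 1
  | ZHBox m n r =>
      \sum_(i : m.-tuple bool) \sum_(j : n.-tuple bool)
        r ^+ (\prod_(b <- i ++ j) (b : nat))%N *: ketbra R j i
  end.

End GeneratorInterpretation.

Definition RING (R : Type) := diagram (ring_gen R).
Definition ZW (R : Type) := diagram (zw_gen R).
Definition ZH (R : Type) := diagram (zh_gen R).

Definition ring_interp (R : comPzRingType) n m (D : RING R n m) :=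
  interp (@ring_gen_interp R) D.
Definition zw_interp (R : comPzRingType) n m (D : ZW R n m) :=
  interp (@zw_gen_interp R) D.
Definition zh_interp (R : comPzRingType) n m (D : ZH R n m) :=
  interp (@zh_gen_interp R) D.

Definition ring_hat (R S : Type) (phi : R -> S) n m (D : RING R n m) : RING S n m :=
  dmap (ring_gen_map phi) D.
Definition zw_hat (R S : Type) (phi : R -> S) n m (D : ZW R n m) : ZW S n m :=
  dmap (zw_gen_map phi) D.
Definition zh_hat (R S : Type) (phi : R -> S) n m (D : ZH R n m) : ZH S n m :=
  dmap (zh_gen_map phi) D.

Lemma bits_val_cat (b c : seq bool) :
  bits_val (b ++ c) = (bits_val b * 2 ^ size c + bits_val c)%N.
Proof.
elim/last_ind: c => [|c x IH]; first by rewrite cats0 /bits_val /= muln1 addn0.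
rewrite -rcons_cat /bits_val !foldl_rcons -!/(bits_val _) IH size_rcons.
by rewrite doubleD -muln2 -mulnA -expnSr addnA.
Qed.

Lemma bits_val_lt (b : seq bool) : (bits_val b < 2 ^ size b)%N.
Proof.
elim/last_ind: b => [|b x IH] //.
rewrite /bits_val foldl_rcons -/(bits_val _) size_rcons expnS mul2n.
by rewrite -[X in (_ < X)%N]addnn; case: x => /=;
  rewrite ?addn0 ?addn1 -?doubleS ?addnn -?[(_.*2 < _)%N]/(_ < _)%N
          ?ltn_double ?ltn_Sdouble.
Qed.

Lemma ket_cat (R : comPzRingType) n m (b : n.-tuple bool) (c : m.-tuple bool) :
  kron (ket R b) (ket R c) = ket R [tuple of b ++ c].
Proof.
apply/matrixP => i j; rewrite /kron castmxE !mxE -natrM mulnb /=.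
congr (_%:R : R); congr nat_of_bool.
rewrite bits_val_cat size_tuple.
have lc : (bits_val c < 2 ^ m)%N by rewrite -{2}(size_tuple c) bits_val_lt.
have p0 : (0 < 2 ^ m)%N by rewrite expn_gt0.
apply/andP/eqP => [[/eqP <- /eqP <-]|->]; first exact: divn_eq.
by rewrite divnMDl // modnMDl (divn_small lc) (modn_small lc) addn0.
Qed.

(* Main.v *)
(** Every matrix entry used to interpret the generators is 0, 1, -1, a label or
    a power of a label.  A ring homomorphism preserves all of these, as well as
    matrix and Kronecker products, so relabelling a diagram along [phi] amounts
    to applying [phi] entrywise to its interpretation. *)
Require Import Defs.
From mathcomp Require Import all_boot all_algebra.

Set Implicit Arguments.
Unset Strict Implicit.
Unset Printing Implicit Defensive.

Import GRing.Theory.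
Local Open Scope ring_scope.

Section MapInterpretation.

Variables (R S : comPzRingType) (phi : {rmorphism R -> S}).

Lemma map_mx_of_rows p q (rows : seq (seq R)) :
  map_mx phi (mx_of_rows p q rows) = mx_of_rows p q (map (map phi) rows).
Proof.
(* No bound on the index is required when the default [x] is sent to the default [y]: the missing
   row [[::]] maps to [[::]], and a missing entry 0 maps to 0. *)
have nth_map_nil T U x y (f : T -> U) s i :
    f x = y -> nth y (map f s) i = f (nth x s i).
  by move=> <-; elim: s i => [|z s IH] [|i] /=.
apply/matrixP => i j; rewrite !mxE.
by rewrite (nth_map_nil _ _ [::]) // (nth_map_nil _ _ 0) ?rmorph0.
Qed.

(** The casts only reindex, so each entry is a product of an entry of [A] and an entry of [B]. *)
Lemma map_kron m1 n1 m2 n2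
    (A : 'M[R]_(2 ^ m1, 2 ^ n1)) (B : 'M[R]_(2 ^ m2, 2 ^ n2)) :
  map_mx phi (kron A B) = kron (map_mx phi A) (map_mx phi B).
Proof. by apply/matrixP => i j; rewrite !(castmxE, mxE) rmorphM. Qed.

Lemma map_ket n (b : n.-tuple bool) : map_mx phi (ket R b) = ket S b.
Proof. by apply/matrixP => i j; rewrite !mxE rmorph_nat. Qed.

Lemma map_ketbra m n (b : m.-tuple bool) (c : n.-tuple bool) :
  map_mx phi (ketbra R b c) = ketbra S b c.
Proof. by rewrite map_mxM -map_trmx !map_ket. Qed.

Lemma map_mx_sum (I : Type) (r : seq I) (P : pred I) p q (F : I -> 'M[R]_(p, q)) :
  map_mx phi (\sum_(i <- r | P i) F i) = \sum_(i <- r | P i) map_mx phi (F i).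
Proof. exact: raddf_sum. Qed.

(** Keeping the generators abstract lets one induction serve all three calculi; only the
    compatibility [gSf] has to be checked for each of them. *)
Lemma interp_dmap (G H : nat -> nat -> Type)
    (gR : forall n m, G n m -> 'M[R]_(2 ^ m, 2 ^ n))
    (gS : forall n m, H n m -> 'M[S]_(2 ^ m, 2 ^ n))
    (f : forall n m, G n m -> H n m)
    (gSf : forall n m (g : G n m), gS n m (f n m g) = map_mx phi (gR n m g))
    n m (D : diagram G n m) :
  interp gS (dmap f D) = map_mx phi (interp gR D).
Proof.
elim: D => {n m} [n m g||||||n k m A IHA B IHB|n1 m1 n2 m2 A IHA B IHB] /=.
- exact: gSf.
- by rewrite map_mx1.
- by rewrite map_mx1.
- by do 2!(rewrite map_mx_sum; apply: eq_bigr => ? _); rewrite map_ketbra.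
- by rewrite map_mx_of_rows /= !rmorph0 !rmorph1.
- by rewrite map_mx_of_rows /= !rmorph0 !rmorph1.
- by rewrite IHA IHB map_mxM.
- by rewrite IHA IHB map_kron.
Qed.

Lemma map_spider m n (r : R) :
  map_mx phi (spider m n r) = spider m n (phi r).
Proof. by rewrite map_mxD map_mxZ !map_ketbra. Qed.

Lemma ring_gen_interp_map n m (g : ring_gen R n m) :
  ring_gen_interp (ring_gen_map phi g) = map_mx phi (ring_gen_interp g).
Proof. by case: g => [a||] /=; rewrite map_mx_of_rows /= ?rmorph0 ?rmorph1. Qed.

Lemma zw_gen_interp_map n m (g : zw_gen R n m) :
  zw_gen_interp (zw_gen_map phi g) = map_mx phi (zw_gen_interp g).
Proof.
case: g => [{}m {}n r|{}n|] /=.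
- by rewrite map_spider.
- by rewrite map_mx_sum; apply: eq_bigr => k _; rewrite map_ket.
- by rewrite map_mx_of_rows /= rmorphN !rmorph0 !rmorph1.
Qed.

Lemma zh_gen_interp_map n m (g : zh_gen R n m) :
  zh_gen_interp (zh_gen_map phi g) = map_mx phi (zh_gen_interp g).
Proof.
(* The unlabelled white spider is [spider] at label 1, which [phi] fixes. *)
case: g => [{}m {}n|{}m {}n r] /=; first by rewrite map_spider rmorph1.
do 2!(rewrite map_mx_sum; apply: eq_bigr => ? _).
(* The exponent of the label is a natural number read off the bits alone, so it is the same over [R]
   and [S]. *)
by rewrite map_mxZ rmorphXn map_ketbra.
Qed.

End MapInterpretation.

Theorem theorem5p42 (R S : comPzRingType) (phi : {rmorphism R -> S}) :
  (forall (n m : nat) (A B : RING R n m),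
     ring_interp A = ring_interp B ->
     ring_interp (ring_hat phi A) = ring_interp (ring_hat phi B)) /\
  (forall (n m : nat) (A B : ZW R n m),
     zw_interp A = zw_interp B ->
     zw_interp (zw_hat phi A) = zw_interp (zw_hat phi B)) /\
  ((exists half : R, 2%:R * half = 1) ->
   forall (n m : nat) (A B : ZH R n m),
     zh_interp A = zh_interp B ->
     zh_interp (zh_hat phi A) = zh_interp (zh_hat phi B)).
Proof.
split; [|split=> [|_]] => n m A B eqAB.
(* [ring_hat] unfolds to [dmap], so both sides become entrywise images under [phi] of the matrices
   that [eqAB] equates. *)
- rewrite /ring_interp !(interp_dmap (ring_gen_interp_map phi)).
  exact: (congr1 (map_mx phi) eqAB).
- rewrite /zw_interp !(interp_dmap (zw_gen_interp_map phi)).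
  exact: (congr1 (map_mx phi) eqAB).
- rewrite /zh_interp !(interp_dmap (zh_gen_interp_map phi)).
  exact: (congr1 (map_mx phi) eqAB).
Qed.
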